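(* Every oriented hypergraph has an algebraic spanning tree over the reals.
   Context: An oriented hypergraph $H=(V,E)$ consists of a finite set $V$ and a set $E$ of ordered pairs $(A,B)$ of disjoint subsets of $V$, where $E$ never contains both $(A,B)$ and $(B,A)$. With real coefficients, $C_0,C_1$ are the real vector spaces with bases $V$, $E$; $\partial_1\colon C_1\to C_0$ is the linear extension of $(A,B)\mapsto\sum_{v\in B}v-\sum_{v\in A}v$; $C^0=\mathrm{Hom}(C_0,\mathbb R)$, $C^1=\mathrm{Hom}(C_1,\mathbb R)$; $\delta^0\colon C^0\to C^1$, $\varphi\mapsto\varphi\circ\partial_1$; $\gamma_1\colon C_1\to C^1$ is the isomorphism with $\gamma_1(e)(e')=\delta_{ee'}$ for $e,e'\in E$. Let $\langle\,,\rangle$ be the inner product on $C_1$ for which $E$ is orthonormal. Put $\mathcal C:=\operatorname{Ker}\partial_1$ and $\mathcal B:=\gamma_1^{-1}(\operatorname{Im}\delta^0)$. A subset $T\subseteq E$ is an algebraic spanning tree (over the reals) if (1) $\mathcal B$ has a basis $(x_t\mid t\in T)$ with $\langle x_t,t'\rangle=\delta_{tt'}$ for all $t,t'\in T$, and (2) $\mathcal C$ has a basis $(x_e\mid e\in E\setminus T)$ with $\langle x_e,e'\rangle=\delta_{ee'}$ for all $e,e'\in E\setminus T$. *)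

(* Defs.v *)
From HB Require Import structures.
From mathcomp Require Import all_boot all_order all_algebra.
From mathcomp Require Import reals.

Set Implicit Arguments.
Unset Strict Implicit.
Unset Printing Implicit Defensive.

Import GRing.Theory.
Local Open Scope ring_scope.

(* [hyperedges_oriented] quantifies over all [A], [B]; for [A = B = set0] it
   excludes the pair [(set0, set0)]. *)
Record oriented_hypergraph := OrientedHypergraph {
  vertex : finType;
  hyperedges : {set {set vertex} * {set vertex}};
  hyperedges_disjoint :
    forall A B, (A, B) \in hyperedges -> [disjoint A & B];
  hyperedges_oriented :
    forall A B, ~ ((A, B) \in hyperedges /\ (B, A) \in hyperedges) }.

Definition edge (H : oriented_hypergraph) : finType :=
  {e : {set vertex H} * {set vertex H} | e \in hyperedges H}.

(* The real vector space with basis a finite type [I]: an element is its family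
   of coordinates, and [i : I] is identified with [bvec R i]. *)
Notation free_space R I := {ffun I -> R^o}.

Section FreeSpace.
Variables (R : realType) (I : finType).

Definition bvec (i : I) : free_space R I := [ffun j => (i == j)%:R].

Definition linext (U : vectType R) (f : I -> U) : 'Hom(free_space R I, U) :=
  linfun (fun x : free_space R I => \sum_i x i *: f i).

Definition inner (x y : free_space R I) : R := \sum_i x i * y i.

Lemma linextE (U : vectType R) (f : I -> U) (x : free_space R I) :
  linext f x = \sum_i x i *: f i.
Proof.
pose g (x : free_space R I) := \sum_i x i *: f i.
have glin : linear g.
  move=> a u v; rewrite /g scaler_sumr -big_split; apply: eq_bigr => i _ /=.
  by rewrite !ffunE scalerDl scalerA.
pose gL := GRing.isLinear.Build R (free_space R I) U *:%R g glin.
pose G : {linear free_space R I -> U} := HB.pack g gL.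
exact: (lfunE G x).
Qed.

Lemma linext_bvec (U : vectType R) (f : I -> U) (i : I) :
  linext f (bvec i) = f i.
Proof.
rewrite linextE (bigD1 i) //= ffunE eqxx scale1r big1 ?addr0 // => j ji.
by rewrite ffunE eq_sym (negPf ji) scale0r.
Qed.

Lemma inner_bvec (i j : I) : inner (bvec i) (bvec j) = (i == j)%:R.
Proof.
rewrite /inner (bigD1 i) //= big1 => [|k ki]; last first.
  by rewrite ffunE eq_sym (negPf ki) mul0r.
by rewrite !ffunE eqxx mul1r addr0 eq_sym.
Qed.

End FreeSpace.

Section Hypergraph.
Variables (R : realType) (H : oriented_hypergraph).

Local Notation chain0 := (free_space R (vertex H)).
Local Notation chain1 := (free_space R (edge H)).
Local Notation cochain0 := ('Hom(chain0, R^o)).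
Local Notation cochain1 := ('Hom(chain1, R^o)).

Definition boundary : 'Hom(chain1, chain0) :=
  linext (fun e : edge H =>
    \sum_(v in (sval e).2) bvec R v - \sum_(v in (sval e).1) bvec R v).

Definition coboundary : 'Hom(cochain0, cochain1) :=
  linfun (fun phi : cochain0 => (phi \o boundary)%VF : cochain1).

Definition gamma : 'Hom(chain1, cochain1) :=
  linext (fun e : edge H =>
    linext (fun e' : edge H => (e == e')%:R : R^o) : cochain1).

Lemma coboundaryE (phi : cochain0) : coboundary phi = (phi \o boundary)%VF.
Proof.
pose g (phi : cochain0) : cochain1 := (phi \o boundary)%VF.
have glin : linear g by move=> a u v; rewrite /g comp_lfunDl comp_lfunZl.
pose gL := GRing.isLinear.Build R cochain0 cochain1 *:%R g glin.
pose G : {linear cochain0 -> cochain1} := HB.pack g gL.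
exact: (lfunE G phi).
Qed.

Lemma gammaE (x y : chain1) : gamma x y = inner x y.
Proof.
rewrite /gamma linextE sum_lfunE; apply: eq_bigr => e _.
rewrite scale_lfunE linextE (bigD1 e) //= eqxx big1 ?addr0 => [|e' ne].
  by rewrite /GRing.scale /= mulr1.
by rewrite eq_sym (negPf ne) scaler0.
Qed.

Lemma gamma_bij : bijective gamma.
Proof.
exists (fun phi : cochain1 => [ffun e => phi (bvec R e)] : chain1).
  move=> x; apply/ffunP=> e; rewrite ffunE gammaE /inner (bigD1 e) //= big1.
    by rewrite ffunE eqxx mulr1 addr0.
  by move=> e' ne; rewrite ffunE eq_sym (negPf ne) mulr0.
move=> phi; apply/lfunP=> y; rewrite gammaE /inner.
have {2}-> : y = \sum_e y e *: bvec R e.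
  apply/ffunP=> e; rewrite sum_ffunE (bigD1 e) //= big1 => [|e' ne].
    by rewrite !ffunE eqxx addr0 /GRing.scale /= mulr1.
  by rewrite !ffunE (negPf ne) scaler0.
rewrite linear_sum; apply: eq_bigr => e _.
by rewrite linearZ ffunE mulrC.
Qed.

Definition cycle_space : {vspace chain1} := lker boundary.
Definition cut_space : {vspace chain1} := (gamma @^-1: limg coboundary)%VS.

(* [x] is total on [edge H]; only its restriction to [S] matters. *)
Definition has_dual_basis (U : {vspace chain1}) (S : {set edge H}) : Prop :=
  exists x : edge H -> chain1,
    basis_of U [seq x s | s in S] /\
    {in S &, forall s s', inner (x s) (bvec R s') = (s == s')%:R}.

Definition algebraic_spanning_tree (T : {set edge H}) : Prop :=
  has_dual_basis cut_space T /\ has_dual_basis cycle_space (~: T).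

End Hypergraph.

(* Main.v *)
Require Import Defs.
From mathcomp Require Import all_boot all_order all_algebra.
From mathcomp Require Import reals.

(* The cycle space is the orthogonal complement of the cut space U. Let T be a
   minimal set of edges such that an element of U vanishing on T is zero. By
   minimality, for t in T some nonzero element of U vanishes on T minus t;
   rescaled, these elements form a basis (x_t) of U dual to T. For e outside T
   the chain e - sum_t <x_t, e> t is orthogonal to every x_t, and these chains
   form the basis of the cycle space dual to the complement of T. *)

Set Implicit Arguments.
Unset Strict Implicit.
Unset Printing Implicit Defensive.

Import GRing.Theory.
Local Open Scope ring_scope.

Section DualFamilies.
Variables (R : realType) (I : finType).
Local Notation space := (free_space R I).
Implicit Types (x y : space) (U : {vspace space}) (S T : {set I}).

Lemma innerDr x y z : inner x (y + z) = inner x y + inner x z.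
Proof. by rewrite -big_split; apply: eq_bigr => i _; rewrite ffunE mulrDr. Qed.

Lemma innerZr a x y : inner x (a *: y) = a * inner x y.
Proof. by rewrite mulr_sumr; apply: eq_bigr => i _; rewrite ffunE mulrCA. Qed.

Lemma inner0r x : inner x 0 = 0.
Proof. by rewrite /inner big1 // => i _; rewrite ffunE mulr0. Qed.

Lemma innerNr x y : inner x (- y) = - inner x y.
Proof. by rewrite -scaleN1r innerZr mulN1r. Qed.

Lemma inner_sumr (J : finType) (P : pred J) x (f : J -> space) :
  inner x (\sum_(j | P j) f j) = \sum_(j | P j) inner x (f j).
Proof. exact: (big_morph _ (innerDr x) (inner0r x)). Qed.

Lemma inner_bvecr x i : inner x (bvec R i) = x i.
Proof.
rewrite /inner (bigD1 i) //= big1 => [|j ji].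
  by rewrite ffunE eqxx mulr1 addr0.
by rewrite ffunE eq_sym (negPf ji) mulr0.
Qed.

(** The difference of the two sides lies in [U] and, by duality, vanishes on [T]. *)
Lemma dual_expansion U T (x : I -> space) :
  {in T, forall t, x t \in U} ->
  {in T &, forall s t, x s t = (s == t)%:R} ->
  (forall u, u \in U -> {in T, forall t, u t = 0} -> u = 0) ->
  forall u, u \in U -> u = \sum_(t in T) u t *: x t.
Proof.
move=> xU xT det u uU; apply/eqP; rewrite -subr_eq0; apply/eqP/det => [|t tT].
  by apply: memvB => //; apply: memv_suml => t tT; apply/memvZ/xU.
rewrite !ffunE sum_ffunE (bigD1 t) //= big1 => [|s /andP[sT st]].
  by rewrite ffunE xT // eqxx /GRing.scale /= mulr1 addr0 subrr.
by rewrite ffunE xT // (negPf st) scaler0.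
Qed.

Lemma dual_family_basis U T (x : I -> space) :
  {in T, forall t, x t \in U} ->
  {in T &, forall s t, x s t = (s == t)%:R} ->
  (forall u, u \in U -> {in T, forall t, u t = 0} -> u = 0) ->
  basis_of U [seq x t | t in T].
Proof.
move=> xU xT det; set X := [seq x t | t in T].
have XU : (<<X>> <= U)%VS.
  by apply/span_subvP=> _ /imageP[t tT ->]; apply: xU.
have UX : (U <= <<X>>)%VS.
  apply/subvP=> u /(dual_expansion xU xT det)->.
  by apply: memv_suml => t tT; apply/memvZ/memv_span/image_f.
have freeX : free X.
  apply: (introT (@freeP _ _ _ (image_tuple x T))) => a aX k.
  (* Evaluating the linear relation at the [k]-th element of [T] isolates the coefficient [a k]. *)
  have := congr1 (fun y : space => y (enum_val k)) aX.
  rewrite sum_ffunE (bigD1 k) //= big1 => [|l lk].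
    rewrite nth_image !ffunE xT ?enum_valP // eqxx addr0.
    by rewrite /GRing.scale /= mulr1.
  rewrite nth_image ffunE xT ?enum_valP // (inj_eq enum_val_inj) (negPf lk).
  exact: scaler0.
by rewrite /basis_of eqEsubv XU UX.
Qed.

(** The linear extension is the coordinate projection onto [T]; its kernel consists of the vectors
    that vanish on [T]. *)
Definition vanishing_subspace U T : {vspace space} :=
  (U :&: lker (linext (fun i => if i \in T then bvec R i else 0%R)))%VS.

Lemma vanishing_subspaceP U T u :
  reflect (u \in U /\ {in T, forall i, u i = 0}) (u \in vanishing_subspace U T).
Proof.
have restrE i : linext (fun i => if i \in T then bvec R i else 0) u i =
    if i \in T then u i else 0.
  rewrite linextE sum_ffunE (bigD1 i) //= big1 => [|j ji].
    rewrite ffunE addr0; case: ifP => _; rewrite !ffunE ?scaler0 //.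
    by rewrite eqxx /GRing.scale /= mulr1.
  rewrite ffunE; case: ifP => _; rewrite !ffunE ?scaler0 //.
  by rewrite (negPf ji) scaler0.
rewrite memv_cap memv_ker; apply: (iffP andP) => -[uU].
  by move=> /eqP u0; split=> // i iT; have := restrE i; rewrite u0 iT ffunE.
move=> u0; split=> //; apply/eqP/ffunP => i.
by rewrite restrE ffunE; case: ifP => // /u0.
Qed.

Lemma exists_dual_family U : exists (T : {set I}) (x : I -> space),
  [/\ {in T, forall t, x t \in U},
      {in T &, forall s t, x s t = (s == t)%:R} &
      forall u, u \in U -> {in T, forall t, u t = 0} -> u = 0].
Proof.
pose P T := vanishing_subspace U T == 0%VS.
have PE T : P T -> forall u, u \in U -> {in T, forall t, u t = 0} -> u = 0.
  move=> /eqP VT u uU uT; apply/eqP; rewrite -memv0 -VT.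
  exact/vanishing_subspaceP.
have [T minT] : {T | minset P T}.
  (* The full set satisfies [P], since a vector with all coordinates zero is zero. *)
  apply: ex_minset; exists setT; rewrite /P -subv0; apply/subvP => u.
  move=> /vanishing_subspaceP[_ u0]; rewrite memv0; apply/eqP/ffunP => i.
  by rewrite u0 ?inE // ffunE.
have PT := minsetp minT.
(* [vpick] returns zero only on the zero subspace, so [v t = 0] would give [P (T :\ t)], against the
   minimality of [T]. *)
pose v t := vpick (vanishing_subspace U (T :\ t)).
have vP t : v t \in U /\ {in T :\ t, forall s, v t s = 0}.
  exact/vanishing_subspaceP/memv_pick.
have vt t : t \in T -> v t t != 0.
  move=> tT; apply/eqP => vt0.
  have : v t = 0.
    apply: (PE _ PT) => [|s sT]; first by case: (vP t).
    have [->//|st] := eqVneq s t.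
    by case: (vP t) => _; apply; rewrite in_setD1 st.
  move/eqP; rewrite vpick0 => PTt.
  by move: tT; rewrite -(minsetinf minT PTt (subD1set T t)) setD11.
exists T, (fun t => (v t t)^-1 *: v t); split; last exact: PE PT.
  by move=> t _; apply: memvZ; case: (vP t).
move=> s t sT tT; rewrite ffunE; have [<-|st] := eqVneq s t.
  by rewrite /GRing.scale /= mulVf // vt.
have [_ v0] := vP s; rewrite (v0 t) ?scaler0 //.
by rewrite in_setD1 eq_sym st tT.
Qed.

Section OrthogonalDual.
Variables (U W : {vspace space}) (T : {set I}) (x : I -> space).
Hypotheses (xU : {in T, forall t, x t \in U})
  (xT : {in T &, forall s t, x s t = (s == t)%:R})
  (det : forall u, u \in U -> {in T, forall t, u t = 0} -> u = 0)
  (orth : forall c, c \in W <-> forall u, u \in U -> inner u c = 0).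

Definition orthogonal_dual (e : I) : space :=
  bvec R e - \sum_(t in T) x t e *: bvec R t.

Lemma orthogonal_dual_mem e : orthogonal_dual e \in W.
Proof.
apply/orth => u uU; rewrite innerDr innerNr inner_bvecr inner_sumr.
(* Only the [u] in [u e] is expanded in the dual family; each term [u t * x t e] then cancels
   against the sum being subtracted. *)
rewrite {1}(dual_expansion xU xT det uU) sum_ffunE -sumrB big1 // => t _.
by rewrite ffunE innerZr inner_bvecr /GRing.scale /= mulrC subrr.
Qed.

Lemma orthogonal_dualE :
  {in ~: T &, forall e f, orthogonal_dual e f = (e == f)%:R}.
Proof.
move=> e f _; rewrite inE => fT; rewrite !ffunE sum_ffunE big1 ?subr0 //.
move=> t tT; rewrite !ffunE; case: eqP => [tf|_]; last exact: scaler0.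
by rewrite -tf tT in fT.
Qed.

(** When [c] vanishes off [T], the product [inner (x t) c] reduces to [c t], and it is zero by
    orthogonality. *)
Lemma orthogonal_det c : c \in W -> {in ~: T, forall e, c e = 0} -> c = 0.
Proof.
move=> /orth cW cT; apply/ffunP => t; rewrite [RHS]ffunE.
have [tT|tT] := boolP (t \in T); last by apply: cT; rewrite inE.
rewrite -(cW _ (xU tT)) /inner (bigD1 t) //= xT // eqxx mul1r big1 ?addr0 //.
move=> s st; have [sT|sT] := boolP (s \in T).
  by rewrite xT // eq_sym (negPf st) mul0r.
by rewrite cT ?mulr0 // inE.
Qed.

End OrthogonalDual.

End DualFamilies.

(** A cut [u] satisfies [gamma u = phi \o boundary] for some [phi], hence
    [inner u c = phi (boundary c)]; letting [phi] run over the coordinate functionals detects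
    whether [boundary c] is zero. *)
Lemma cycle_space_orthogonal (R : realType) (H : oriented_hypergraph)
    (c : free_space R (edge H)) :
  c \in cycle_space R H <->
  forall u, u \in cut_space R H -> inner u c = 0.
Proof.
rewrite /cycle_space memv_ker; split=> [/eqP dc u | cut0].
  rewrite /cut_space -memv_preim => /memv_imgP[phi _ phiE].
  by rewrite -gammaE phiE coboundaryE comp_lfunE dc linear0.
apply/eqP/ffunP => w; rewrite [RHS]ffunE.
pose phi : 'Hom(free_space R (vertex H), R^o) :=
  linext (fun v => (v == w)%:R : R^o).
have phiE y : phi y = y w.
  rewrite /phi linextE (bigD1 w) //= eqxx big1 => [|v /negPf->].
    by rewrite addr0 /GRing.scale /= mulr1.
  exact: scaler0.
have [g _ gammaK] := gamma_bij R H.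
(* The coordinate of [boundary c] at [w] becomes the inner product of [c] with the cut
   [g (coboundary R H phi)]. *)
rewrite -phiE -comp_lfunE -coboundaryE -[coboundary R H phi]gammaK gammaE.
by apply: cut0; rewrite /cut_space -memv_preim gammaK memv_img ?memvf.
Qed.

Theorem theorem6 (R : realType) (H : oriented_hypergraph) :
  exists T : {set edge H}, algebraic_spanning_tree R T.
Proof.
have [T [x [xU xT det]]] := exists_dual_family (cut_space R H).
have orth := @cycle_space_orthogonal R H.
exists T; split.
  exists x; split; first exact: dual_family_basis.
  by move=> s t sT tT; rewrite inner_bvecr xT.
exists (orthogonal_dual T x); split.
  apply: dual_family_basis => [e _||c].
  - exact: orthogonal_dual_mem xU xT det orth e.
  - exact: orthogonal_dualE.
  - exact: orthogonal_det xU xT orth c.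
by move=> e f eT fT; rewrite inner_bvecr orthogonal_dualE.
Qed.
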